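(* Let $(W,\omega)$ be a symplectic manifold of dimension $2n$, let $G$ be an abelian group, and let $\mathcal{L}_1=\{[N]^1_a\in J^1_n(W): \omega(a)|_{T_aN}=0\}$ be the first-order PDE encoding Lagrangian submanifolds of $W$. Then the $G$-singular bordism group of compact submanifolds of $W$ bording by means of Lagrangian submanifolds of $W$, i.e. the closed $G$-singular bordism group ${}^G\Omega^{\mathcal{L}_1}_{\bullet,s}$ of $\mathcal{L}_1$ (in degree $n-1$ for $(n-1)$-dimensional compact submanifolds bording by $n$-dimensional Lagrangian submanifolds), is given by $${}^G\Omega^{\mathcal{L}_1}_{\bullet,s}\cong \bar H_\bullet(\mathcal{L}_1;G).$$ Moreover: - If ${}^G\Omega^{\mathcal{L}_1}_{\bullet,s}=0$, then $\overline{Bor}_\bullet(\mathcal{L}_1;G)\cong\overline{Cyc}_\bullet(\mathcal{L}_1;G)$. - If $\overline{Cyc}_\bullet(\mathcal{L}_1;G)$ is a free $G$-module, then $$\overline{Bor}_\bullet(\mathcal{L}_1;G)\cong {}^G\Omega^{\mathcal{L}_1}_{\bullet,s}\oplus\overline{Cyc}_\bullet(\mathcal{L}_1;G).$$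
   Context: **Jets.** For an $n$-dimensional submanifold $N\subset W$ and $a\in N$, $[N]^1_a$ is the first-order jet of $N$ at $a$; $J^1_n(W)$ is the manifold of all such jets (the bundle of $n$-dimensional tangent planes of $W$). $N^{(1)}=\{[N]^1_a:a\in N\}$. The Cartan distribution $\mathbf{E}^1_n(W)\subset TJ^1_n(W)$ is generated by the tangent spaces of the prolongations $N^{(1)}$ of $n$-dimensional submanifolds $N\subset W$. For a PDE $E\subset J^1_n(W)$ (a submanifold), $\mathbf{E}=\mathbf{E}^1_n(W)\cap TE$. A Lagrangian submanifold is an $n$-dimensional submanifold $V\subset W$ with $\omega|_V=0$; equivalently $V^{(1)}\subset\mathcal{L}_1$. **Bar singular chains of a PDE $E$.** $\bar C_p(E;G)$ is the module of formal finite linear combinations $\sum\lambda_i c_i$, $\lambda_i\in G$, where each $c_i$ is a singular $p$-simplex $f:\Delta^p\to E$ that extends to a differentiable map on a neighbourhood $U\subset\mathbb{R}^{p+1}$ of $\Delta^p$ and satisfies $Tf(\Delta^p)\subset\mathbf{E}$ (i.e. $f$ is tangent to the Cartan distribution). With the boundary $\bar\partial$ this is the bar singular chain complex; $\bar B_\bullet(E;G)=\mathrm{im}\,\bar\partial$, $\bar Z_\bullet(E;G)=\ker\bar\partial$, and $\bar H_\bullet(E;G)=\bar Z_\bullet/\bar B_\bullet$ is the bar singular homology. **Bordism groups.** $\overline{Bor}_\bullet(E;G)=\bar C_\bullet(E;G)/\bar B_\bullet(E;G)$ (chains $a,b$ are equivalent iff $a-b=\bar\partial c$ for some chain $c$).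 $\overline{Cyc}_\bullet(E;G)=\bar C_\bullet(E;G)/\bar Z_\bullet(E;G)$ ($a,b$ equivalent iff $\bar\partial(a-b)=0$). The closed $G$-singular bordism group ${}^G\Omega^{E}_{\bullet,s}$ is the group of closed chains ($\bar\partial a=0$) modulo the relation $a-b=\bar\partial c$; it is the kernel of the canonical surjection $\overline{Bor}_\bullet(E;G)\to\overline{Cyc}_\bullet(E;G)$. *)

(* Defs.v *)
From HB Require Import structures.
From mathcomp Require Import all_boot all_order all_algebra.
From mathcomp Require Import generic_quotient ring_quotient finmap.
From mathcomp Require Import all_classical all_reals all_analysis.
Set Implicit Arguments.
Unset Strict Implicit.
Unset Printing Implicit Defensive.
Import Order.TTheory GRing.Theory Num.Theory.
Import numFieldNormedType.Exports.
Local Open Scope classical_set_scope.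
Local Open Scope ring_scope.

Section Isomorphic.
Variable K : nzRingType.

Definition isomorphic (V V' : lmodType K) : Prop :=
  exists f : {linear V -> V'}, bijective f.

End Isomorphic.

Section Submodule.
Variables (K : nzRingType) (V : lmodType K) (S : submodClosed V).

Record submodule := Submodule { submodule_val : V; _ : submodule_val \in S }.
HB.instance Definition _ := [isSub for submodule_val].
HB.instance Definition _ := [Choice of submodule by <:].
HB.instance Definition _ := [SubChoice_isSubLmodule of submodule by <:].

End Submodule.

(* mathcomp's Quotient.quot only carries a zmodType structure *)
Section QuotientModule.
Variables (K : nzRingType) (V : lmodType K) (S : submodClosed V).

(* a submodClosed predicate is not canonically a zmodClosed one *)
Definition kernel_pred : {pred V} := S.
Fact kernel_pred_zmod_closed : zmod_closed kernel_pred.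
Proof.
split=> [|x y Sx Sy]; first exact: (rpred0 S).
by apply: (@rpredD _ S) => //; rewrite -scaleN1r; apply: (@rpredZ _ _ S).
Qed.
HB.instance Definition _ :=
  GRing.isZmodClosed.Build V kernel_pred kernel_pred_zmod_closed.

Definition quotient_module : Type := Quotient.quot kernel_pred.
HB.instance Definition _ := GRing.Zmodule.on quotient_module.

Definition quotient_proj (x : V) : quotient_module :=
  \pi_(Quotient.quot kernel_pred)%qT x.

Lemma quotient_projP x y : quotient_proj x = quotient_proj y <-> x - y \in S.
Proof.
rewrite (Quotient.idealrBE kernel_pred x y); split=> [e|/eqP //].
by apply/eqP.
Qed.

Lemma quotient_proj_surj (q : quotient_module) : exists x, q = quotient_proj x.
Proof. by exists (repr (q : Quotient.quot kernel_pred)); rewrite /quotient_proj reprK. Qed.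

Lemma quotient_projD x y :
  quotient_proj (x + y) = quotient_proj x + quotient_proj y.
Proof. exact: (raddfD (\pi_(Quotient.quot kernel_pred)%qT)). Qed.

Definition quotient_scale (k : K) (q : quotient_module) : quotient_module :=
  quotient_proj (k *: repr (q : Quotient.quot kernel_pred)).

Lemma quotient_scaleE k x :
  quotient_scale k (quotient_proj x) = quotient_proj (k *: x).
Proof.
apply/quotient_projP; rewrite -scalerBr rpredZ//; apply/quotient_projP.
by rewrite /quotient_proj reprK.
Qed.

Fact quotient_scaleA a b v :
  quotient_scale a (quotient_scale b v) = quotient_scale (a * b) v.
Proof.
by have [x ->] := quotient_proj_surj v; rewrite !quotient_scaleE scalerA.
Qed.

Fact quotient_scale1 : left_id 1 quotient_scale.
Proof.
by move=> v; have [x ->] := quotient_proj_surj v;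
  rewrite quotient_scaleE scale1r.
Qed.

Fact quotient_scaleDr : right_distributive quotient_scale +%R.
Proof.
move=> a u v; have [x ->] := quotient_proj_surj u.
have [y ->] := quotient_proj_surj v.
by rewrite -quotient_projD !quotient_scaleE scalerDr quotient_projD.
Qed.

Fact quotient_scaleDl v :
  {morph quotient_scale^~ v : a b / a + b >-> a + b}.
Proof.
move=> a b; have [x ->] := quotient_proj_surj v.
by rewrite !quotient_scaleE scalerDl quotient_projD.
Qed.

HB.instance Definition _ := GRing.Zmodule_isLmodule.Build K quotient_module
  quotient_scaleA quotient_scale1 quotient_scaleDr quotient_scaleDl.

Fact quotient_proj_linear : linear quotient_proj.
Proof.
by move=> a x y; rewrite quotient_projD -quotient_scaleE.
Qed.

HB.instance Definition _ := GRing.isLinear.Build K V quotient_module *:%R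
  quotient_proj quotient_proj_linear.

End QuotientModule.

Section FormalCombinations.
Variables (K : nzRingType) (T : Type) (V : lmodType K).

Definition finsupp_pred : {pred T -> V} :=
  [pred c : T -> V | `[< finite_set [set t | c t != 0] >] ].

Fact finsupp_submod_closed : submod_closed finsupp_pred.
Proof.
split.
  rewrite inE.
  suff -> : [set t : T | (0 : T -> V) t != 0] = set0 by exact: finite_set0.
  by rewrite -subset0 => t /=; rewrite eqxx.
move=> a u v; rewrite !inE => fu fv.
apply: (@sub_finite_set _ _ ([set t | u t != 0] `|` [set t | v t != 0])).
  move=> t /=; apply: contraPP => /not_orP[].
  move=> /negP/negPn/eqP u0 /negP/negPn/eqP v0.
  by rewrite -[_ t]/(a *: u t + v t) u0 v0 scaler0 addr0 eqxx.
by rewrite finite_setU.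
Qed.

HB.instance Definition _ :=
  GRing.isSubmodClosed.Build K (T -> V) finsupp_pred finsupp_submod_closed.

(* formal finite linear combinations of elements of T with coefficients in V *)
Definition formal_sum := submodule finsupp_pred.
Definition coef (c : formal_sum) : T -> V := submodule_val c.

Lemma finite_coef (c : formal_sum) : finite_set [set t | coef c t != 0].
Proof. by have := valP c; rewrite inE. Qed.

End FormalCombinations.

Definition free_module (K : nzRingType) (M : lmodType K) : Prop :=
  exists T : Type, isomorphic M (formal_sum T K^o).

Section SmoothMaps.
Variables (R : realType) (V V' : normedModType R).

Fixpoint class_C (r : nat) (A : set V) (f : V -> V') : Prop :=
  if r is r'.+1 then
    (forall x, A x -> differentiable f x) /\
    (forall v, class_C r' A (fun x => 'D_v f x))
  else forall x, A x -> {for x, continuous f}.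

Definition smooth_on (A : set V) (f : V -> V') : Prop :=
  forall r, class_C r A f.

Definition linear_span (A : set V) : set V :=
  [set v | exists m (a : 'I_m -> R) (e : 'I_m -> V),
     (forall i, A (e i)) /\ v = \sum_i a i *: e i].

End SmoothMaps.

Section Manifolds.
Variables (R : realType) (d : nat).

(* cmap and cinv are total functions; only their values on cdom and
   cmap @` cdom matter *)
Record chart (W : topologicalType) := Chart {
  cdom : set W;
  cmap : W -> 'rV[R]_d;
  cinv : 'rV[R]_d -> W;
  cdom_open : open cdom;
  cimage_open : open (cmap @` cdom);
  cmapK : forall a, cdom a -> cinv (cmap a) = a;
  cmap_continuous : forall a, cdom a -> {for a, continuous cmap};
  cinv_continuous :
    forall y, (cmap @` cdom) y -> {for y, continuous cinv} }.

Definition compatible (W : topologicalType) (c c' : chart W) : Prop :=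
  smooth_on (cmap c @` (cdom c `&` cdom c')) (cmap c' \o cinv c) /\
  smooth_on (cmap c' @` (cdom c `&` cdom c')) (cmap c \o cinv c').

(* matlas is the maximal atlas; mchart_at a is a preferred chart at a, used to
   identify T_a W with 'rV[R]_d *)
Record manifold := Manifold {
  mpoint :> topologicalType;
  mhausdorff : hausdorff_space mpoint;
  msecond_countable : @second_countable mpoint;
  matlas : set (chart mpoint);
  mcompatible : forall c c', matlas c -> matlas c' -> compatible c c';
  mmaximal : forall c, (forall c', matlas c' -> compatible c c') -> matlas c;
  mchart_at : mpoint -> chart mpoint;
  mchart_at_atlas : forall a, matlas (mchart_at a);
  mchart_at_dom : forall a, cdom (mchart_at a) a }.

(* the components in the chart c of a tangent vector at a *)
Definition tcoord (W : manifold) (c : chart W) (a : W) :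
    'rV[R]_d -> 'rV[R]_d :=
  'd (cmap c \o cinv (mchart_at a)) (cmap (mchart_at a) a).

(* components, with respect to the coordinate system (dom, coord), of the
   velocities at 0 of the curves through q that are differentiable at 0 and
   lie in the subset S *)
Definition velocities (X : Type) (V : normedModType R) (dom : set X)
    (coord : X -> V) (S : set X) (q : X) : set V :=
  [set v | exists gamma : R -> X,
     [/\ gamma 0 = q,
         \forall t \near (0 : R), S (gamma t) /\ dom (gamma t) &
         is_derive (0 : R^o) (1 : R^o) (coord \o gamma) v] ].

Definition tangent_space (W : manifold) (N : set W) (a : W) : set 'rV[R]_d :=
  velocities (cdom (mchart_at a)) (cmap (mchart_at a)) N a.

Definition submanifold (W : manifold) (n : nat) (N : set W) : Prop :=
  forall a, N a -> exists c, [/\ matlas c, cdom c a &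
    forall b, cdom c b ->
      N b <-> forall j : 'I_d, (n <= j)%N -> cmap c b 0 j = 0 ].

(* The matrix in the chart c, at the point of coordinates y, of the field of
   bilinear forms omega; omega a is the matrix of the form on
   T_a W = 'rV[R]_d, the form being (u, v) |-> u *m omega a *m v^T. *)
Definition form_in_chart (W : manifold) (omega : W -> 'M[R]_d) (c : chart W)
    (y : 'rV[R]_d) : 'M[R]_d :=
  let a := cinv c y in
  let J := jacobian (cmap (mchart_at a) \o cinv c) y in
  J *m omega a *m J^T.

Record symplectic_form (W : manifold) := SymplecticForm {
  sform : W -> 'M[R]_d;
  sform_skew : forall a, (sform a)^T = - sform a;
  sform_smooth : forall c, matlas c ->
    smooth_on (cmap c @` cdom c) (form_in_chart sform c);
  sform_closed : forall c, matlas c ->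
    forall y, (cmap c @` cdom c) y -> forall i j k : 'I_d,
      let dform (i j k : 'I_d) :=
        ('D_(delta_mx 0 i) (form_in_chart sform c) y) j k in
      dform i j k + dform j k i + dform k i j = 0;
  sform_nondegenerate : forall a (u : 'rV[R]_d),
    (forall v : 'rV[R]_d, u *m sform a *m v^T = 0) -> u = 0 }.

Definition form_at (W : manifold) (omega : symplectic_form W) (a : W)
    (u v : 'rV[R]_d) : R := (u *m sform omega a *m v^T) 0 0.

End Manifolds.

(* First-order jets of n-dimensional submanifolds of W, dim W = n + k *)
Section Jets.
Variables (R : realType) (n k : nat) (W : manifold R (n + k)).

(* two submanifolds have the same 1-jet at a iff they have the same tangent
   space at a *)
Record jet := Jet {
  jpoint : W;
  jplane : set 'rV[R]_(n + k);
  jetP : exists N, [/\ submanifold n N, N jpoint &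
                       jplane = tangent_space N jpoint] }.

Definition prolongation (N : set W) : set jet :=
  [set q | N (jpoint q) /\ jplane q = tangent_space N (jpoint q)].

(* A chart c = (x, u) : W -> R^n x R^k induces the jet coordinates
   (x, u, u_x) on the planes that are graphs over R^n; the entry (i, j) of the
   matrix slope is the coordinate u^j_i. *)
Definition plane_in_chart (c : chart R (n + k) W) (q : jet) :
    set 'rV[R]_(n + k) :=
  tcoord c (jpoint q) @` jplane q.

Definition graph_of_slope (A : 'M[R]_(n, k)) : set 'rV[R]_(n + k) :=
  [set w | rsubmx w = lsubmx w *m A].

Definition jdom (c : chart R (n + k) W) : set jet :=
  [set q | cdom c (jpoint q) /\
           exists A, plane_in_chart c q = graph_of_slope A].

Definition jcoord (c : chart R (n + k) W) (q : jet) :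
    'rV[R]_(n + k) * 'M[R]_(n, k) :=
  (cmap c (jpoint q),
   get [set A | plane_in_chart c q = graph_of_slope A]).

(* Tangent vectors to the jet manifold at q are given by their components in
   the jet coordinates induced by the chart c. *)
Definition cartan (c : chart R (n + k) W) (q : jet) :
    set ('rV[R]_(n + k) * 'M[R]_(n, k)) :=
  linear_span [set v | exists N, [/\ submanifold n N, prolongation N q &
    velocities (jdom c) (jcoord c) (prolongation N) q v] ].

Definition cartan_PDE (E : set jet) (c : chart R (n + k) W) (q : jet) :
    set ('rV[R]_(n + k) * 'M[R]_(n, k)) :=
  cartan c q `&` velocities (jdom c) (jcoord c) E q.

Definition jet_differentiable (V : normedModType R) (g : V -> jet) (x : V) :
    Prop :=
  forall c, matlas c -> jdom c (g x) ->
    (\forall y \near x, jdom c (g y)) /\ differentiable (jcoord c \o g) x.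

Definition tangent_to_cartan (E : set jet) (V : normedModType R) (g : V -> jet)
    (x v : V) : Prop :=
  forall c, matlas c -> jdom c (g x) ->
    cartan_PDE E c (g x) ('D_v (jcoord c \o g) x).

End Jets.

Definition lagrangian_PDE (R : realType) (n : nat) (W : manifold R (n + n))
    (omega : symplectic_form W) : set (jet W) :=
  [set q | forall u v, jplane q u -> jplane q v ->
     form_at omega (jpoint q) u v = 0].

Section StandardSimplex.
Variable R : realType.

Definition std_simplex (p : nat) : set 'rV[R]_p.+1 :=
  [set x | (forall i, 0 <= x 0 i) /\ \sum_i x 0 i = 1].

(* x *m face_mx i inserts a zero in position i *)
Definition face_mx (p : nat) (i : 'I_p.+2) : 'M[R]_(p.+1, p.+2) :=
  \matrix_(j, l) (l == lift i j)%:R.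

Lemma sum_face_mx p (i : 'I_p.+2) (x : 'rV[R]_p.+1) :
  \sum_l (x *m face_mx i) 0 l = \sum_j x 0 j.
Proof.
under eq_bigr do rewrite mxE.
rewrite exchange_big; apply: eq_bigr => j _ /=.
rewrite (bigD1 (lift i j))//= mxE eqxx mulr1 big1 ?addr0// => l /negPf lij.
by rewrite mxE lij mulr0.
Qed.

Lemma std_simplex_face p (i : 'I_p.+2) (x : 'rV[R]_p.+1) :
  std_simplex x -> std_simplex (x *m face_mx i).
Proof.
move=> [x0 x1]; split; last by rewrite sum_face_mx.
move=> l; rewrite mxE sumr_ge0// => j _.
by rewrite mulr_ge0// mxE ler0n.
Qed.

Definition face_incl p (i : 'I_p.+2) (x : @std_simplex p) : @std_simplex p.+1 :=
  SigSub (mem_set (std_simplex_face i (set_mem (valP x)))).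

Lemma differentiable_mulmxr m n (M : 'M[R]_(m, n)) (x : 'rV[R]_m) :
  differentiable (fun y : 'rV[R]_m => y *m M) x.
Proof.
rewrite (_ : (fun _ => _) =
  \sum_(j < m) ((fun y : 'rV[R]_m => y 0 j *: row j M))).
  apply: differentiable_sum => j.
  exact/differentiableZl/differentiable_coord.
apply/funext => y; rewrite fct_sumE mulmx_sum_row.
by [].
Qed.

End StandardSimplex.

Section BarSimplices.
Variables (R : realType) (n k : nat) (W : manifold R (n + k)) (E : set (jet W)).

(* The tangent vectors to the simplex are the v with \sum_i v_i = 0. *)
Definition is_bar_simplex (p : nat) (f : @std_simplex R p -> jet W) : Prop :=
  exists (U : set 'rV[R]_p.+1) (g : 'rV[R]_p.+1 -> jet W),
    [/\ open U, @std_simplex R p `<=` U,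
        forall x : @std_simplex R p, f x = g (val x),
        forall x, U x -> E (g x) /\ jet_differentiable g x &
        forall x (v : 'rV[R]_p.+1), std_simplex x -> \sum_i v 0 i = 0 ->
          tangent_to_cartan E g x v].

Record bar_simplex (p : nat) := BarSimplex {
  bar_map :> @std_simplex R p -> jet W;
  bar_mapP : is_bar_simplex bar_map }.
HB.instance Definition _ p := gen_eqMixin (bar_simplex p).
HB.instance Definition _ p := gen_choiceMixin (bar_simplex p).

Lemma is_bar_simplex_face p (f : bar_simplex p.+1) (i : 'I_p.+2) :
  is_bar_simplex (f \o face_incl i).
Proof.
have [U [g [oU sU fg gU tg]]] := bar_mapP f.
pose L (x : 'rV[R]_p.+1) := x *m face_mx R i.
have dL x : differentiable L x by exact: differentiable_mulmxr.
have cL : continuous L by move=> x; exact: differentiable_continuous.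
exists (L @^-1` U), (g \o L); split.
- by apply: open_comp => // x _; exact: cL.
- by move=> x /(std_simplex_face i) /sU.
- by move=> x /=; rewrite fg.
- move=> x Ux; have [Eg dg] := gU _ Ux; split=> // c Wc domc.
  have [near_dom dgc] := dg c Wc domc; split; first exact: cL near_dom.
  exact: (differentiable_comp (dL x) dgc).
- move=> x v sx v0 c Wc domc.
  have : tangent_to_cartan E g (L x) (L v).
    by apply: tg; [exact: std_simplex_face|rewrite sum_face_mx].
  move=> /(_ c Wc domc).
  suff -> : 'D_(L v) (jcoord c \o g) (L x) =
            'D_v (jcoord c \o (g \o L)) x by [].
  rewrite /derive; set F := (X in lim (X @ _) = _).
  set F' := (X in _ = lim (X @ _)); suff -> : F = F' by [].
  apply/funext => h; rewrite /F /F' /=.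
  by rewrite /L mulmxDl scalemxAl.
Qed.

Definition face p (i : 'I_p.+2) (f : bar_simplex p.+1) : bar_simplex p :=
  BarSimplex (is_bar_simplex_face f i).

End BarSimplices.

(* Chains have coefficients in a module G over an arbitrary ring K, and
   "module", "free" and "isomorphic" refer to K.  An abelian group G is the case
   K = int with the module zmodule G; a ring G acting on itself is the case K = G. *)
Section BarComplex.
Variables (R : realType) (n k : nat) (W : manifold R (n + k)) (E : set (jet W)).
Variables (K : nzRingType) (G : lmodType K).

Definition bar_chain (p : nat) := formal_sum (bar_simplex E p) G.

(* the coefficient at s of the sum of (-1)^i c_f (f o face_incl i) *)
Definition boundary_coef p (c : bar_chain p.+1) (s : bar_simplex E p) : G :=
  \sum_(f \in [set: bar_simplex E p.+1])
    \sum_(i < p.+2 | face i f == s) (-1) ^+ i *: coef c f.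

Lemma boundary_coefE p (c : bar_chain p.+1) (s : bar_simplex E p)
    (A : set (bar_simplex E p.+1)) :
  finite_set A -> [set f | coef c f != 0] `<=` A ->
  boundary_coef c s = \sum_(f <- fset_set A)
    \sum_(i < p.+2 | face i f == s) (-1) ^+ i *: coef c f.
Proof.
move=> finA cA; rewrite /boundary_coef -fsbig_finite//.
apply/esym; apply: fsbig_widen => // f [_ /= nAf].
rewrite big1// => i _.
suff -> : coef c f = 0 by rewrite scaler0.
by apply/eqP; apply: contra_notT nAf => cf; exact: cA.
Qed.

Lemma finsupp_boundary_coef p (c : bar_chain p.+1) :
  boundary_coef c \in @finsupp_pred K (bar_simplex E p) G.
Proof.
rewrite inE; have finc := finite_coef c.
apply: (@sub_finite_set _ _
  (\bigcup_(i in [set: 'I_p.+2]) (face i @` [set f | coef c f != 0]))).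
  move=> s /=; rewrite (boundary_coefE s finc)//; apply: contraPP => ns.
  apply/negP/negPn/eqP; rewrite big_seq big1// => f.
  rewrite in_fset_set// inE => cf; rewrite big1// => i /eqP fs.
  by exfalso; apply: ns; exists i => //; exists f.
apply: bigcup_finite; first exact: finite_finset.
by move=> i _; exact: finite_image.
Qed.

Definition boundary p (c : bar_chain p.+1) : bar_chain p :=
  Submodule (finsupp_boundary_coef c).

Fact boundary_linear p : linear (@boundary p).
Proof.
move=> a c c'; apply/val_inj/funext => s /=.
rewrite -[RHS]/(a *: boundary_coef c s + boundary_coef c' s).
have fc := finite_coef c; have fc' := finite_coef c'.
pose A := [set f | coef c f != 0] `|` [set f | coef c' f != 0].
have fA : finite_set A by rewrite finite_setU.
rewrite !(boundary_coefE s fA).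
- rewrite scaler_sumr -big_split; apply: eq_bigr => f _ /=.
  rewrite scaler_sumr -big_split; apply: eq_bigr => i _ /=.
  rewrite [X in _ *: X = _](_ : _ = a *: coef c f + coef c' f)//.
  rewrite scalerDr !scalerA.
  by rewrite commr_sign.
- by move=> f cf; right.
- by move=> f cf; left.
- move=> f; apply: contraPP => /not_orP[/negP/negPn/eqP f0 /negP/negPn/eqP f0'].
  apply/negP/negPn/eqP; transitivity (a *: coef c f + coef c' f) => //.
  by rewrite f0 f0' scaler0 addr0.
Qed.

HB.instance Definition _ p := GRing.isLinear.Build K (bar_chain p.+1)
  (bar_chain p) *:%R (@boundary p) (@boundary_linear p).

(* all chains of degree 0 are closed *)
Definition closed_chain p : bar_chain p -> Prop :=
  if p is p'.+1 then fun c => boundary c = 0 else fun=> True.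

Definition cycles p : {pred bar_chain p} := [pred c | `[< closed_chain c >] ].
Definition boundaries p : {pred bar_chain p} :=
  [pred b | `[< exists c, b = boundary c >] ].

Fact cycles_submod_closed p : submod_closed (@cycles p).
Proof.
split; first by rewrite inE; case: p => //= p; rewrite linear0.
move=> a u v; rewrite !inE; case: p u v => //= p u v u0 v0.
by rewrite linearP /= u0 v0 scaler0 addr0.
Qed.
HB.instance Definition _ p := GRing.isSubmodClosed.Build K (bar_chain p)
  (@cycles p) (@cycles_submod_closed p).

Fact boundaries_submod_closed p : submod_closed (@boundaries p).
Proof.
split; first by rewrite inE; exists 0; rewrite linear0.
move=> a u v; rewrite !inE => -[c ->] [c' ->].
by exists (a *: c + c'); rewrite linearP.
Qed.
HB.instance Definition _ p := GRing.isSubmodClosed.Build K (bar_chain p)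
  (@boundaries p) (@boundaries_submod_closed p).

Definition boundary_cycles p : {pred submodule (@cycles p)} :=
  [pred z | submodule_val z \in @boundaries p].

Fact boundary_cycles_submod_closed p : submod_closed (@boundary_cycles p).
Proof.
have [B0 BD] := boundaries_submod_closed p.
split=> [|a u v Bu Bv]; first by have -> : (0 \in @boundary_cycles p) =
  (0 \in @boundaries p) by [].
have -> : (a *: u + v \in @boundary_cycles p) =
  (a *: submodule_val u + submodule_val v \in @boundaries p) by [].
exact: BD.
Qed.
HB.instance Definition _ p := GRing.isSubmodClosed.Build K
  (submodule (@cycles p)) (@boundary_cycles p) (@boundary_cycles_submod_closed p).

Definition bar_homology p := quotient_module (@boundary_cycles p).

Definition Bor p := quotient_module (@boundaries p).

Definition Cyc p := quotient_module (@cycles p).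

(* the classes of closed chains for the relation a - b = boundary c *)
Definition closed_classes p : {pred Bor p} :=
  [pred x | `[< exists2 a, closed_chain a & x = quotient_proj (@boundaries p) a >] ].

Fact closed_classes_submod_closed p : submod_closed (@closed_classes p).
Proof.
have [Z0 ZD] := cycles_submod_closed p.
split=> [|a u v]; rewrite !inE.
  by exists 0; [move: Z0; rewrite inE|rewrite linear0].
move=> [x Zx ->] [y Zy ->]; exists (a *: x + y); last by rewrite linearP.
by have := ZD a x y; rewrite !inE; apply.
Qed.
HB.instance Definition _ p := GRing.isSubmodClosed.Build K (Bor p)
  (@closed_classes p) (@closed_classes_submod_closed p).

Definition closed_bordism p := submodule (@closed_classes p).

End BarComplex.

(* Main.v *)
Require Import Defs.
From HB Require Import structures.
From mathcomp Require Import all_boot all_order all_algebra zify.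
From mathcomp Require Import finmap.
From mathcomp Require Import all_classical all_reals all_analysis.
Set Implicit Arguments.
Unset Strict Implicit.
Unset Printing Implicit Defensive.
Import GRing.Theory.
Local Open Scope classical_set_scope.
Local Open Scope ring_scope.

(** The statement is homological algebra of the bar complex of a first-order
    equation.

    Sending a cycle to its class modulo boundaries maps the cycles onto the
    closed bordism group, with kernel the boundaries, so the first isomorphism
    theorem identifies that group with homology ([closed_bordism_homology]).

    The geometric fact behind the rest is that the boundary of a boundary vanishes
    ([boundary_boundary]): the double faces of a simplex cancel in pairs.  Hence
    every boundary is a cycle, chains modulo boundaries map onto chains modulo
    cycles, and the kernel consists of the classes of cycles.  This is the
    short exact sequence

      0 -> closed_bordism -> Bor -> Cyc -> 0

    of [Bor_Cyc_exact].  If its left term vanishes, the surjection is an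
    isomorphism.  If [Cyc] is free, the surjection has a linear section,
    obtained by lifting a basis ([free_lift]), and the sequence splits
    ([splitting]). *)

(** * Quotients and split extensions of modules *)

Section Modules.
Variable K : nzRingType.

Lemma linear_inverse (V V' : lmodType K) (f : {linear V -> V'}) :
  bijective f -> exists g : {linear V' -> V}, cancel f g /\ cancel g f.
Proof.
move=> [g fK gK].
have gL : linear g.
  by move=> a x y; apply: (can_inj fK); rewrite linearP !gK.
pose h : {linear V' -> V} := HB.pack g (GRing.isLinear.Build K V' V *:%R g gL).
by exists h.
Qed.

Lemma isomorphic_of_trivial_kernel (V V' : lmodType K) (f : {linear V -> V'}) :
  (forall y, exists x, f x = y) -> (forall x, f x = 0 -> x = 0) ->
  isomorphic V V'.
Proof.
move=> /choice[g gK] f0; exists f, g => // x.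
by apply/eqP; rewrite -subr_eq0; apply/eqP/f0; rewrite linearB /= gK subrr.
Qed.

Lemma quotient_proj_eq0 (V : lmodType K) (S : submodClosed V) (x : V) :
  quotient_proj S x = 0 <-> x \in S.
Proof. by rewrite -(linear0 (quotient_proj S)) quotient_projP subr0. Qed.

Lemma quotient_lift (V V' : lmodType K) (S : submodClosed V)
    (f : {linear V -> V'}) :
  (forall x, x \in S -> f x = 0) ->
  exists g : {linear quotient_module S -> V'},
    forall x, g (quotient_proj S x) = f x.
Proof.
move=> fS.
pose g (q : quotient_module S) := f (xget 0 [set x | q = quotient_proj S x]).
have gE x : g (quotient_proj S x) = f x.
  rewrite /g; case: xgetP => [y _ /quotient_projP/fS|noP]; last by case: (noP x).
  by rewrite linearB => /subr0_eq ->.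
have gL : linear g.
  move=> a q r; have [x ->] := quotient_proj_surj q.
  have [y ->] := quotient_proj_surj r.
  by rewrite -linearP !gE linearP.
pose h : {linear quotient_module S -> V'} :=
  HB.pack g (GRing.isLinear.Build K (quotient_module S) V' *:%R g gL).
by exists h.
Qed.

Lemma first_isomorphism (V V' : lmodType K) (S : submodClosed V)
    (f : {linear V -> V'}) :
  (forall y, exists x, f x = y) -> (forall x, f x = 0 <-> x \in S) ->
  isomorphic (quotient_module S) V'.
Proof.
move=> fsurj fS; have [|g gE] := @quotient_lift _ _ S f; first by move=> x /fS.
apply: (@isomorphic_of_trivial_kernel _ _ g) => [y|q].
  by have [x <-] := fsurj y; exists (quotient_proj S x).
have [x ->] := quotient_proj_surj q; rewrite gE => /fS.
by move/quotient_proj_eq0.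
Qed.

(** [x - s (f x)] is the component of [x] in the kernel, so that every [x]
    decomposes uniquely along the kernel and the image of the section. *)
Lemma splitting (V V' : lmodType K) (S : submodClosed V)
    (f : {linear V -> V'}) (s : {linear V' -> V}) :
  (forall x, f x = 0 <-> x \in S) -> (forall y, f (s y) = y) ->
  isomorphic V (submodule S * V')%type.
Proof.
move=> fS fs.
have proj_in x : x - s (f x) \in S by apply/fS; rewrite linearB /= fs subrr.
pose h x : (submodule S * V')%type := (Submodule (proj_in x), f x).
have hL : linear h.
  move=> a x y; congr pair; last by rewrite linearP.
  apply: val_inj.
  change (a *: x + y - s (f (a *: x + y)) = a *: (x - s (f x)) + (y - s (f y))).
  by rewrite (linearP f) (linearP s) scalerBr opprD addrACA.
pose hh : {linear V -> (submodule S * V')%type} :=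
  HB.pack h (GRing.isLinear.Build K V (submodule S * V')%type *:%R h hL).
exists hh, (fun u => val u.1 + s u.2) => [x /=|[[x Sx] y]]; first by rewrite subrK.
have fxy : f (x + s y) = y by rewrite linearD /= fs (fS x).2 ?add0r.
by congr pair => //; apply: val_inj; rewrite /= fxy addrK.
Qed.

(** * Linear maps out of a free module *)

Section FreeLifting.
Variables (T : Type) (V : lmodType K).

(** [{classic T}] is [T] with a choice operator, which sums of finite support
    require of their index type. *)
Definition linear_extension (b : T -> V) (c : formal_sum T K^o) : V :=
  \sum_(t \in [set: {classic T}]) coef c t *: b t.

(** Linearity compares the sums attached to several combinations, whose
    supports differ; a common finite set containing all of them makes the sums
    comparable term by term. *)
Lemma linear_extensionE (b : T -> V) (c : formal_sum T K^o)
    (A : set {classic T}) :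
  finite_set A -> [set t | coef c t != 0] `<=` A ->
  linear_extension b c = \sum_(t <- fset_set A) coef c t *: b t.
Proof.
move=> finA cA; rewrite /linear_extension -fsbig_finite//.
apply/esym; apply: fsbig_widen => // t [_ /= nAt].
suff -> : coef c t = 0 by rewrite scale0r.
by apply/eqP; apply: contra_notT nAt => ct; exact: cA.
Qed.

Lemma linear_extension_linear (b : T -> V) : linear (linear_extension b).
Proof.
move=> a c c'.
have fc := finite_coef c; have fc' := finite_coef c'.
pose A : set {classic T} := [set t | coef c t != 0] `|` [set t | coef c' t != 0].
have fA : finite_set A by rewrite finite_setU.
have coefD t : coef (a *: c + c') t = (a : K) * coef c t + coef c' t by [].
rewrite !(linear_extensionE _ fA).
- rewrite scaler_sumr -big_split; apply: eq_bigr => t _ /=.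
  by rewrite scalerA -scalerDl.
- by move=> t ct; right.
- by move=> t ct; left.
- move=> t; apply: contraPP => /not_orP[/negP/negPn/eqP t0 /negP/negPn/eqP t0'].
  by apply/negP/negPn/eqP; rewrite coefD t0 t0' mulr0 addr0.
Qed.

HB.instance Definition _ (b : T -> V) := GRing.isLinear.Build K
  (formal_sum T K^o) V *:%R (linear_extension b) (@linear_extension_linear b).

Lemma single_finsupp (t : T) :
  (fun u : T => (`[< u = t >])%:R) \in @finsupp_pred K T K^o.
Proof.
rewrite inE; apply: (@sub_finite_set _ _ [set t]); last exact: finite_set1.
by move=> u /=; case: asboolP => //; rewrite eqxx.
Qed.

Definition single (t : T) : formal_sum T K^o := Submodule (single_finsupp t).

End FreeLifting.

(** A linear map is determined by its values on the basis, since
    [c] is the sum of the [coef c t *: single t]. *)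
Lemma linear_extension_single (T : Type) (V : lmodType K)
  (e : {linear formal_sum T K^o -> V}) (c : formal_sum T K^o) :
  linear_extension (fun t => e (single t)) c = e c.
Proof.
have fc := finite_coef c.
rewrite (@linear_extensionE T V _ c [set t | coef c t != 0])//.
under eq_bigr do rewrite -linearZ.
rewrite -linear_sum; congr (e _); apply: val_inj; rewrite linear_sum.
apply/funext => u; rewrite fct_sumE /=.
transitivity (\sum_(t <- fset_set [set t : {classic T} | coef c t != 0])
    if t == u then coef c u else 0).
  apply: eq_bigr => t _.
  rewrite -[LHS]/(coef c t * (`[< u = t >])%:R :> K).
  case: eqP => [->|tu]; first by rewrite asboolT// mulr1.
  by rewrite asboolF ?mulr0// => /esym.
have [cu|/negPn/eqP cu] := boolP (coef c u != 0); last first.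
  by rewrite big1 => [|t _]; rewrite ?cu ?if_same.
rewrite (bigD1_seq (u : {classic T}))//= ?eqxx.
- by rewrite big1 ?addr0// => t /negPf ->.
- by rewrite in_fset_set// inE.
- exact: fset_uniq.
Qed.

(** Free modules are projective: lift each basis vector of [M] through [f] and
    extend linearly. *)
Lemma free_lift (M V : lmodType K) (f : {linear V -> M}) :
  free_module M -> (forall y, exists x, f x = y) ->
  exists s : {linear M -> V}, forall y, f (s y) = y.
Proof.
move=> [T [e /linear_inverse[e' [eK _]]]] /choice[l lK].
exists (linear_extension (fun t => l (e' (single t))) \o e) => y /=.
rewrite -[RHS]eK -(linear_extension_single e').
set c := e y; have fc := finite_coef c.
rewrite !(@linear_extensionE T _ _ c [set t | coef c t != 0])// linear_sum.
by apply: eq_bigr => t _; rewrite linearZ /= lK.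
Qed.

End Modules.

(** * The boundary of a boundary *)

(** Antisymmetry alone gives only that twice the sum is zero.  To allow
    2-torsion, the terms below the diagonal are cancelled against their mirror
    images above it. *)
Lemma antisymmetric_sum0 (V : zmodType) m (F : 'I_m -> 'I_m -> V) :
  (forall a, F a a = 0) -> (forall a b, F a b = - F b a) ->
  \sum_a \sum_b F a b = 0.
Proof.
move=> F0 FN.
have split_row (a : 'I_m) : \sum_b F a b =
    \sum_(b < m | (b < a)%N) F a b - \sum_(b < m | (a < b)%N) F b a.
  rewrite (bigID (fun b : 'I_m => (b < a)%N)) /=; congr (_ + _).
  rewrite -sumrN (bigD1 a) ?ltnn//= F0 add0r.
  apply: eq_big => [b|b _]; last exact: FN.
  by rewrite -leqNgt ltn_neqAle andbC eq_sym.
under eq_bigr do rewrite split_row.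
rewrite sumrB (exchange_big_dep predT)//=.
by rewrite subrr.
Qed.

(** Both sides enumerate in increasing order the integers other than [a] and
    [b]. *)
Lemma bump_bump (a j b i l : nat) :
  bump a j = b -> bump b i = a -> bump a (bump j l) = bump b (bump i l).
Proof. by rewrite /bump; lia. Qed.

Section Boundary.
Variables (R : realType) (n k : nat) (W : manifold R (n + k)) (E : set (jet W)).

Lemma bar_simplex_eq p (f g : bar_simplex E p) :
  (forall x, f x = g x) -> f = g.
Proof.
case: f g => f fP [g gP] /= /funext fg; subst g.
by congr BarSimplex; exact: Prop_irrelevance.
Qed.

Lemma face_mx_mul p (a : 'I_p.+3) (j : 'I_p.+2) :
  face_mx R j *m face_mx R a = \matrix_(l, m) (m == lift a (lift j l))%:R.
Proof.
apply/matrixP => l m; rewrite !mxE (bigD1 (lift j l))//= !mxE eqxx mul1r.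
by rewrite big1 ?addr0// => q /negPf qj; rewrite !mxE qj mul0r.
Qed.

(** The simplicial identity in symmetric form: a double face depends only on
    the unordered pair of deleted vertices [a] and [b], and not on which of the
    two is deleted first. *)
Lemma face_face p (a b : 'I_p.+3) (i j : 'I_p.+2) (f : bar_simplex E p.+2) :
  lift a j = b -> lift b i = a -> face j (face a f) = face i (face b f).
Proof.
move=> ab ba; apply: bar_simplex_eq => x /=; congr (bar_map f _).
apply: val_inj => /=; rewrite -!mulmxA !face_mx_mul; congr (_ *m _).
apply/matrixP => l m; rewrite !mxE; congr (_ == _)%:R.
apply: val_inj => /=; apply: bump_bump.
- by move: ab => /(congr1 val).
- by move: ba => /(congr1 val).
Qed.

Variables (K : nzRingType) (G : lmodType K).

(** Indexing a double face by the ordered pair of distinct deleted vertices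
    [(a, lift a j)] rather than by [(a, j)], exchanging the two vertices keeps
    the face and changes the parity of [j + a]: the position of the larger
    vertex drops by one when the smaller one has already been deleted. *)
Lemma double_face_sum0 p (f : bar_simplex E p.+2) (s : bar_simplex E p) (c : G) :
  \sum_a \sum_(j | face j (face a f) == s)
     (-1) ^+ j *: ((-1) ^+ a *: c) = 0.
Proof.
(* the terms of the sum, extended by zero to the diagonal *)
pose F (a b : 'I_p.+3) : G := if unlift a b is Some j then
  if face j (face a f) == s then (-1) ^+ (j + a) *: c else 0 else 0.
rewrite -[RHS](@antisymmetric_sum0 _ _ F).
- apply: eq_bigr => a _; rewrite (bigD1_ord a)//= /F unlift_none add0r.
  rewrite big_mkcond; apply: eq_bigr => j _ /=.
  by rewrite liftK scalerA -exprD.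
- by move=> a; rewrite /F unlift_none.
- move=> a b; rewrite /F.
  case: unliftP => [j bE|->]; last by rewrite unlift_none oppr0.
  case: unliftP => [i aE|ab]; last first.
    by move/eqP: bE; rewrite ab -[_ == _]negbK neq_lift.
  rewrite (face_face f (esym bE) (esym aE)); case: ifP => _; last by rewrite oppr0.
  rewrite -scaleNr; congr (_ *: c).
  have : odd (i + b) = ~~ odd (j + a).
    have := congr1 val aE; have := congr1 val bE; rewrite /= /bump; lia.
  rewrite -(signr_odd _ (j + a)) -(signr_odd _ (i + b)) => ->.
  by case: (odd _); rewrite ?opprK.
Qed.

Lemma boundary_boundary p (c : bar_chain E G p.+2) : boundary (boundary c) = 0.
Proof.
apply/val_inj/funext => s; change (boundary_coef (boundary c) s = 0).
pose A := [set f | coef c f != 0]; have finA : finite_set A := finite_coef c.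
(* a finite set of simplices supporting the boundary of c *)
pose B := \bigcup_(i in [set: 'I_p.+3]) (face i @` A).
have finB : finite_set B.
  by apply: bigcup_finite => [|i _]; [exact: finite_finset|exact: finite_image].
have coefE g : coef (boundary c) g = \sum_(f <- fset_set A)
    \sum_(i < p.+3 | face i f == g) (-1) ^+ i *: coef c f.
  exact: boundary_coefE.
have supB : [set g | coef (boundary c) g != 0] `<=` B.
  move=> g; rewrite -[X in X -> _]/(is_true (coef (boundary c) g != 0)).
  apply: contraPP => ng; apply/negP/negPn/eqP; rewrite coefE.
  rewrite big_seq big1// => f; rewrite in_fset_set// inE => Af.
  by rewrite big1// => i /eqP fg; exfalso; apply: ng; exists i => //; exists f.
rewrite (boundary_coefE s finB supB).
under eq_bigr => g _.
  under eq_bigr => j _ do rewrite coefE scaler_sumr.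
  rewrite exchange_big /=; over.
rewrite exchange_big /= big_seq big1// => f; rewrite in_fset_set// inE => Af.
rewrite -[RHS](double_face_sum0 f s (coef c f)).
transitivity (\sum_(g <- fset_set B) \sum_(i < p.+3 | face i f == g)
    \sum_(j < p.+2 | face j g == s) (-1) ^+ j *: ((-1) ^+ i *: coef c f)).
  apply: eq_bigr => g _; rewrite exchange_big /=; apply: eq_bigr => j _.
  by rewrite scaler_sumr.
(* for fixed i, only the simplex g = face i f contributes *)
rewrite (exchange_big_dep predT)//=; apply: eq_bigr => i _.
rewrite big_mkcond (bigD1_seq (face i f))//= ?eqxx.
- by rewrite [X in _ + X]big1 ?addr0// => g /negPf; rewrite eq_sym => ->.
- by rewrite in_fset_set// inE; exists i => //; exists f.
- exact: fset_uniq.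
Qed.

(** * The exact sequence of bordism groups *)

Lemma boundaries_are_cycles p (c : bar_chain E G p) :
  c \in boundaries (E := E) (G := G) (p := p) ->
  c \in cycles (E := E) (G := G) (p := p).
Proof.
rewrite !inE => -[d ->]; case: p c d => // p _ d /=.
exact: boundary_boundary.
Qed.

Lemma Bor_Cyc_exact p : exists pi : {linear Bor E G p -> Cyc E G p},
  (forall y, exists x, pi x = y) /\
  (forall x, pi x = 0 <-> x \in closed_classes (E := E) (G := G) (p := p)).
Proof.
have [pi piE] := @quotient_lift _ _ _ (boundaries (E := E) (G := G) (p := p))
  (quotient_proj (cycles (E := E) (G := G) (p := p)))
  (fun c Bc => (quotient_proj_eq0 _ _).2 (boundaries_are_cycles Bc)).
exists pi; split=> [y|x].
  by have [c ->] := quotient_proj_surj y; exists (quotient_proj _ c).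
rewrite inE; split=> [|[c Zc ->]]; last first.
  by rewrite piE; apply/quotient_proj_eq0; rewrite inE.
have [c ->] := quotient_proj_surj x; rewrite piE => /quotient_proj_eq0.
by rewrite inE => Zc; exists c.
Qed.

Lemma closed_bordism_homology p :
  isomorphic (bar_homology E G p) (closed_bordism E G p).
Proof.
have class_closed (z : submodule (cycles (E := E) (G := G) (p := p))) :
    quotient_proj (boundaries (E := E) (G := G) (p := p)) (val z)
      \in closed_classes (E := E) (G := G) (p := p).
  by rewrite inE; exists (val z) => //; have := valP z; rewrite inE.
pose h z : closed_bordism E G p := Submodule (class_closed z).
have hL : linear h by move=> a x y; apply: val_inj; rewrite /= !linearP.
pose hh : {linear submodule (cycles (E := E) (G := G) (p := p)) ->
    closed_bordism E G p} := HB.pack h (GRing.isLinear.Build K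
  (submodule (cycles (E := E) (G := G) (p := p))) (closed_bordism E G p)
  *:%R h hL).
apply: (@first_isomorphism _ _ _ _ hh) => [[y Zy]|z].
  have := Zy; rewrite inE => -[c Zc yE].
  have Zc' : c \in cycles (E := E) (G := G) (p := p) by rewrite inE.
  by exists (Submodule Zc'); apply: val_inj.
split=> [/(congr1 val)/quotient_proj_eq0//|Bz].
by apply: val_inj; apply/quotient_proj_eq0.
Qed.

End Boundary.

Theorem theorem4p5 (R : realType) (n : nat) (W : manifold R (n + n))
    (omega : symplectic_form W) (K : nzRingType) (G : lmodType K) (p : nat) :
  let L1 := lagrangian_PDE omega in
  [/\ isomorphic (closed_bordism L1 G p) (bar_homology L1 G p),
      (forall x : closed_bordism L1 G p, x = 0) ->
        isomorphic (Bor L1 G p) (Cyc L1 G p) &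
      free_module (Cyc L1 G p) ->
        isomorphic (Bor L1 G p) (closed_bordism L1 G p * Cyc L1 G p)%type].
Proof.
move=> L1; have [pi [pi_surj pi_ker]] := Bor_Cyc_exact L1 G p; split.
- have [f /linear_inverse[g [fK gK]]] := closed_bordism_homology L1 G p.
  by exists g, f.
- move=> Omega0; apply: (@isomorphic_of_trivial_kernel _ _ _ pi) => // x.
  by move=> /pi_ker Zx; have /(congr1 val) := Omega0 (Submodule Zx).
- by move=> /free_lift/(_ pi_surj)[s piK]; exact: splitting pi_ker piK.
Qed.
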